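(* Let $G$ and $H$ be two finitely generated groups with $G$ non-trivial, and let $X$ be a set on which $H$ acts with finitely many orbits. The wreath product $G \wr_X H$ has property FW if and only if $G$ and $H$ have property FW and $X$ is finite.
   Context: Generating sets are symmetric: $S\subset G$ satisfies $s\in S$ if and only if $s^{-1}\in S$. Graphs are undirected. Schreier graph: for a group $G$ with symmetric generating set $S$ and a subgroup $L\le G$, the (left) Schreier graph $\mathrm{Sch}(G,L;S)$ is the graph whose vertices are the left cosets $gL$, with, for every $\{s,s^{-1}\}\subset S$, an edge between $gL$ and $sgL$. Ends: for a graph $\Gamma$ and a finite set $K$ of vertices, $\Gamma\setminus K$ is the graph obtained by deleting the vertices in $K$ and all edges containing them. The number of ends of $\Gamma$ is the supremum, over all finite sets of vertices $K$, of the number of infinite connected components of $\Gamma\setminus K$. For a finitely generated group $G$ and a subgroup $L$, the number of ends of $\mathrm{Sch}(G,L;S)$ does not depend on the choice of the finite generating set $S$. Property FW: a finitely generated group $G$ has property FW if all its Schreier graphs (with respect to a finite symmetric generating set, over all subgroups of $G$) have at most one end. Wreath product: for a set $X$ with a left action of $H$, $\bigoplus_X G$ is the group, under pointwise multiplication, of functions $\varphi\colon X\to G$ with $\varphi(x)=1$ for all but finitely many $x$. The group $H$ acts on it by $(h.\varphi)(x)=\varphi(h^{-1}.x)$, and the (restricted) wreath product is $G\wr_X H=(\bigoplus_X G)\rtimes H$. Under the hypotheses of the statement, $G\wr_X H$ is finitely generated.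
   Formalization: The set X is assumed non-empty: for empty X, G = Z and H trivial, the wreath product is trivial and has property FW although G does not. *)

(* Defs.v *)
From HB Require Import structures.
From Stdlib Require Import Relation_Operators.
From mathcomp Require Import all_boot all_order all_algebra.
From mathcomp Require Import boolp classical_sets functions cardinality.
From mathcomp Require Import constructive_ereal.

Set Implicit Arguments.
Unset Strict Implicit.
Unset Printing Implicit Defensive.

Local Open Scope classical_set_scope.
Local Open Scope group_scope.

(* Undirected graphs. Loops are allowed; multiplicities of edges are not
   recorded, as they do not affect connected components. *)
Record graph := Graph {
  vertex :> Type;
  adjacent : vertex -> vertex -> Prop;
  adjacent_sym : forall x y, adjacent x y -> adjacent y x
}.

Definition delete_adjacent (Gam : graph) (K : set Gam) (x y : ~` K) : Prop :=
  adjacent (\val x) (\val y).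

Lemma delete_adjacent_sym (Gam : graph) (K : set Gam) (x y : ~` K) :
  delete_adjacent x y -> delete_adjacent y x.
Proof. exact: adjacent_sym. Qed.

Definition delete (Gam : graph) (K : set Gam) : graph :=
  Graph (@delete_adjacent_sym Gam K).

Definition connected_component (Gam : graph) (x : Gam) : set Gam :=
  [set y | clos_refl_trans Gam (@adjacent Gam) x y].

Definition infinite_components (Gam : graph) : set (set Gam) :=
  [set C | (exists x, C = connected_component x) /\ infinite_set C].
Arguments infinite_components : clear implicits.

(* The number of elements of a set, in the integers extended with infinities. *)
Definition ecard (T : Type) (A : set T) : \bar int :=
  if pselect (finite_set A) is left finA
  then (Posz (sval (cid finA)))%:E
  else +oo%E.

(* The set below is nonempty (take K empty), so the default value of supremum
   is irrelevant. *)
Definition number_of_ends (Gam : graph) : \bar int :=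
  supremum 0%E
    [set ecard (infinite_components (delete K)) | K in finite_set (T := Gam)].

Definition symmetric_set (G : groupType) (S : set G) : Prop :=
  forall s : G, S s <-> S s^-1.

(* Subgroups are boolean predicates (groupClosed); classically, every subgroup
   of G is of this form. *)
Definition generates (G : groupType) (S : set G) : Prop :=
  forall L : groupClosed G, (forall s, S s -> s \in L) -> forall g, g \in L.

Definition finitely_generated (G : groupType) : Prop :=
  exists S : set G, finite_set S /\ generates S.

Definition left_coset (G : groupType) (L : groupClosed G) (g : G) : set G :=
  [set g * l | l in [set` L]].

Definition left_cosets (G : groupType) (L : groupClosed G) : set (set G) :=
  range (left_coset L).

Definition schreier_adjacent (G : groupType) (L : groupClosed G) (S : set G)
    (A B : left_cosets L) : Prop :=
  exists s g, S s /\
    ((\val A = left_coset L g /\ \val B = left_coset L (s * g)) \/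
     (\val B = left_coset L g /\ \val A = left_coset L (s * g))).

Lemma schreier_adjacent_sym (G : groupType) (L : groupClosed G) (S : set G)
    (A B : left_cosets L) :
  schreier_adjacent S A B -> schreier_adjacent S B A.
Proof. by move=> [s [g [Ss AB]]]; exists s, g; split=> //; apply/or_comm. Qed.

Definition schreier_graph (G : groupType) (L : groupClosed G) (S : set G) :
  graph := Graph (@schreier_adjacent_sym G L S).

Definition property_FW (G : groupType) : Prop :=
  finitely_generated G /\
  forall S : set G, finite_set S -> symmetric_set S -> generates S ->
  forall L : groupClosed G, (number_of_ends (schreier_graph L S) <= 1)%E.

Record left_action (H : groupType) (X : Type) := LeftAction {
  act :> H -> X -> X;
  act1 : forall x, act 1 x = x;
  actM : forall h k x, act (h * k) x = act h (act k x)
}.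

Definition act_orbit (H : groupType) (X : Type) (a : left_action H X) (x : X) :
  set X := range (fun h => a h x).

Definition finitely_many_orbits (H : groupType) (X : Type)
    (a : left_action H X) : Prop :=
  finite_set (range (act_orbit a)).

Record dirsum (X : Type) (G : groupType) := DirSum {
  dirsum_fun :> X -> G;
  dirsum_finite : finite_set [set x | dirsum_fun x <> 1]
}.

Lemma dirsumP (X : Type) (G : groupType) (phi psi : dirsum X G) :
  (forall x, phi x = psi x) -> phi = psi.
Proof.
case: phi psi => [f ff] [g fg] /= /funext e; subst g.
by rewrite (Prop_irrelevance ff fg).
Qed.

HB.instance Definition _ (X : Type) (G : groupType) :=
  gen_eqMixin (dirsum X G).
HB.instance Definition _ (X : Type) (G : groupType) :=
  gen_choiceMixin (dirsum X G).

Lemma dirsum_one_finite (X : Type) (G : groupType) :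
  finite_set [set x : X | (1 : G) <> 1].
Proof. by apply: (sub_finite_set (B := set0)) => // x /=; apply. Qed.

Lemma dirsum_mul_finite (X : Type) (G : groupType) (phi psi : dirsum X G) :
  finite_set [set x | phi x * psi x <> 1].
Proof.
apply: (sub_finite_set (B := [set x | phi x <> 1] `|` [set x | psi x <> 1])).
  move=> x /= ne1; have [e|] := pselect (phi x = 1); last by left.
  by right=> e'; apply: ne1; rewrite e e' mul1g.
by rewrite finite_setU; split; exact: dirsum_finite.
Qed.

Lemma dirsum_inv_finite (X : Type) (G : groupType) (phi : dirsum X G) :
  finite_set [set x | (phi x)^-1 <> 1].
Proof.
apply: (sub_finite_set _ (dirsum_finite phi)) => x /= ne1 e.
by apply: ne1; rewrite e invg1.
Qed.

Definition dirsum_one (X : Type) (G : groupType) : dirsum X G :=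
  DirSum (@dirsum_one_finite X G).
Definition dirsum_mul (X : Type) (G : groupType) (phi psi : dirsum X G) :
  dirsum X G := DirSum (dirsum_mul_finite phi psi).
Definition dirsum_inv (X : Type) (G : groupType) (phi : dirsum X G) :
  dirsum X G := DirSum (dirsum_inv_finite phi).

Lemma dirsum_mulA (X : Type) (G : groupType) :
  associative (@dirsum_mul X G).
Proof. by move=> f g h; apply: dirsumP => x /=; rewrite mulgA. Qed.
Lemma dirsum_mul1 (X : Type) (G : groupType) :
  left_id (dirsum_one X G) (@dirsum_mul X G).
Proof. by move=> f; apply: dirsumP => x /=; rewrite mul1g. Qed.
Lemma dirsum_mulr1 (X : Type) (G : groupType) :
  right_id (dirsum_one X G) (@dirsum_mul X G).
Proof. by move=> f; apply: dirsumP => x /=; rewrite mulg1. Qed.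
Lemma dirsum_mulV (X : Type) (G : groupType) :
  left_inverse (dirsum_one X G) (@dirsum_inv X G) (@dirsum_mul X G).
Proof. by move=> f; apply: dirsumP => x /=; rewrite mulVg. Qed.
Lemma dirsum_mulrV (X : Type) (G : groupType) :
  right_inverse (dirsum_one X G) (@dirsum_inv X G) (@dirsum_mul X G).
Proof. by move=> f; apply: dirsumP => x /=; rewrite mulgV. Qed.

HB.instance Definition _ (X : Type) (G : groupType) :=
  isGroup.Build (dirsum X G) (@dirsum_mulA X G) (@dirsum_mul1 X G)
    (@dirsum_mulr1 X G) (@dirsum_mulV X G) (@dirsum_mulrV X G).

Lemma dirsum_act_finite (H : groupType) (X : Type) (a : left_action H X)
    (G : groupType) (h : H) (phi : dirsum X G) :
  finite_set [set x | phi (a h^-1 x) <> 1].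
Proof.
apply: (sub_finite_set _ (finite_image (a h) (dirsum_finite phi))).
by move=> x /= ne1; exists (a h^-1 x) => //; rewrite -actM mulgV act1.
Qed.

Definition dirsum_act (H : groupType) (X : Type) (a : left_action H X)
    (G : groupType) (h : H) (phi : dirsum X G) : dirsum X G :=
  DirSum (dirsum_act_finite a h phi).

Record wreath (G H : groupType) (X : Type) (a : left_action H X) := Wreath {
  wreath_base : dirsum X G;
  wreath_top : H
}.
Arguments wreath G {H X} a.

HB.instance Definition _ (G H : groupType) (X : Type) (a : left_action H X) :=
  gen_eqMixin (wreath G a).
HB.instance Definition _ (G H : groupType) (X : Type) (a : left_action H X) :=
  gen_choiceMixin (wreath G a).

Definition wreath_one (G H : groupType) (X : Type) (a : left_action H X) :
  wreath G a := Wreath a 1 1.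
Definition wreath_mul (G H : groupType) (X : Type) (a : left_action H X)
    (u v : wreath G a) : wreath G a :=
  Wreath a (wreath_base u * dirsum_act a (wreath_top u) (wreath_base v))
    (wreath_top u * wreath_top v).
Definition wreath_inv (G H : groupType) (X : Type) (a : left_action H X)
    (u : wreath G a) : wreath G a :=
  Wreath a (dirsum_act a (wreath_top u)^-1 (wreath_base u)^-1)
    (wreath_top u)^-1.

Lemma wreathP (G H : groupType) (X : Type) (a : left_action H X)
    (u v : wreath G a) :
  (forall x, wreath_base u x = wreath_base v x) ->
  wreath_top u = wreath_top v -> u = v.
Proof. by case: u v => [f h] [g k] /= /dirsumP -> ->. Qed.

Lemma wreath_mulA (G H : groupType) (X : Type) (a : left_action H X) :
  associative (@wreath_mul G H X a).
Proof.
move=> u v w; apply: wreathP => [x|] /=; last exact: mulgA.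
by rewrite invgM actM mulgA.
Qed.
Lemma wreath_mul1 (G H : groupType) (X : Type) (a : left_action H X) :
  left_id (wreath_one G a) (@wreath_mul G H X a).
Proof.
move=> u; apply: wreathP => [x|] /=; last exact: mul1g.
by rewrite invg1 act1 mul1g.
Qed.
Lemma wreath_mulr1 (G H : groupType) (X : Type) (a : left_action H X) :
  right_id (wreath_one G a) (@wreath_mul G H X a).
Proof. by move=> u; apply: wreathP => [x|] /=; exact: mulg1. Qed.
Lemma wreath_mulV (G H : groupType) (X : Type) (a : left_action H X) :
  left_inverse (wreath_one G a) (@wreath_inv G H X a) (@wreath_mul G H X a).
Proof. by move=> u; apply: wreathP => [x|] /=; exact: mulVg. Qed.
Lemma wreath_mulrV (G H : groupType) (X : Type) (a : left_action H X) :
  right_inverse (wreath_one G a) (@wreath_inv G H X a) (@wreath_mul G H X a).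
Proof.
move=> u; apply: wreathP => [x|] /=; last exact: mulgV.
by rewrite invgK -actM mulgV act1 mulgV.
Qed.

HB.instance Definition _ (G H : groupType) (X : Type) (a : left_action H X) :=
  isGroup.Build (wreath G a) (@wreath_mulA G H X a) (@wreath_mul1 G H X a)
    (@wreath_mulr1 G H X a) (@wreath_mulV G H X a) (@wreath_mulrV G H X a).

(* Main.v *)
Require Import Defs.
From HB Require Import structures.
From Stdlib Require Import Relation_Operators Operators_Properties.
From mathcomp Require Import all_boot all_order all_algebra.
From mathcomp Require Import boolp classical_sets cardinality.
From mathcomp Require Import constructive_ereal.

Set Implicit Arguments.
Unset Strict Implicit.
Unset Printing Implicit Defensive.

(** A subset A of a set Y with an action of a group K is commensurated when
kA and A differ by finitely many points for every k in K. Call K transfixing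
when every commensurated subset of every K-set is almost equal to an invariant
one. The proof replaces property FW by this condition: for a finitely generated
group the two are equivalent ([property_FW_transfixes] and
[transfixes_property_FW]). Indeed, in a connected locally finite graph, having
at most one end means that every set of vertices with finite edge boundary is
finite or has finite complement, and in a Schreier graph the sets with finite
edge boundary are the commensurated sets of cosets. A general K-set is a union
of such coset spaces; since K is finitely generated, a commensurated set is a
union of orbits away from finitely many orbits, so that it can be corrected
orbit by orbit.

Suppose that the wreath product W is transfixing. So is its quotient H. If c is
an action of G on Y, then W acts on Y * X: the top group permutes the fibres
Y * {x}, and a base element phi acts on the fibre over x through phi x. For the
left translations of G, the set {1} * X is commensurated, because a base element
moves only finitely many of its points; but an invariant set contains either
all or nothing of a fibre G * {x}, and {1} * X meets each fibre in one point
while G is not trivial, so X is finite ([transfixes_wreath_finite]). Once X is finite,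
a commensurated subset A of any G-set Y yields the commensurated subset A * X of
Y * X, and a fibre of an invariant set almost equal to A * X is invariant under
G and almost equal to A ([transfixes_wreath_base]).

For the converse, start with a commensurated subset of a W-set and make it
invariant under more and more of W: first under the copies of G, adjoining one
point of X at a time, and then under H. Each of these steps adjoins a
transfixing group that normalises what has been treated so far, and is an
instance of [transfixes_extension]. *)

Local Open Scope classical_set_scope.
Local Open Scope group_scope.

Import Order.TTheory Num.Theory.

(** * Ends and finite cuts of a graph *)

Lemma ecard_le1 (T : Type) (A : set T) :
  (ecard A <= 1)%E <-> is_subset1 A.
Proof.
rewrite /ecard; case: pselect => [finA|infA]; last first.
  split=> // A1; case: infA; have [-> //|/set0P[x Ax]] := eqVneq A set0.
  by apply: (sub_finite_set (B := [set x])) => // y Ay; exact: A1.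
case: cid => n /= An; rewrite lee_fin lez_nat.
split=> [n1 x y Ax Ay|A1].
  have /card_set_bijP[f [fun_f inj_f _]] := An.
  have f0 z : A z -> f z = 0%N.
    by move=> /fun_f /= fz; apply/eqP; rewrite -leqn0 -ltnS (leq_trans fz).
  by apply: inj_f; rewrite ?inE ?f0.
rewrite leqNgt; apply/negP => n2; move: An; rewrite card_eq_sym.
case/card_bijP=> g /bij_inj inj_g.
have n1 : (0 < n)%N by exact: ltn_trans n2.
pose i0 : `I_n := exist _ 0%N (mem_set n1).
pose i1 : `I_n := exist _ 1%N (mem_set n2).
have /inj_g /(congr1 val) // : g i0 = g i1.
by apply: val_inj; apply: A1; exact: set_valP.
Qed.

Lemma ecard_nat (T : Type) (A : set T) :
  ecard A = +oo%E \/ exists n : nat, ecard A = (Posz n)%:E.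
Proof. by rewrite /ecard; case: pselect => ?; [right; eexists|left]. Qed.

(** The supremum of a set without least upper bound is a default value, so the
existence of one has to be checked. If some natural number bounds the set then
the least such number is the supremum, and otherwise +oo is. *)
Lemma supremums_nat (E : set (\bar int)) :
  E !=set0 -> (forall e, E e -> e = +oo%E \/ exists n : nat, e = (Posz n)%:E) ->
  supremums E !=set0.
Proof.
move=> [e0 Ee0] natE; have := natE _ Ee0.
have [exE|unb] := pselect (exists n : nat, `[< ubound E (Posz n)%:E >]).
  case: (ex_minnP exE) => m /asboolP Em m_min e0_nat.
  exists (Posz m)%:E; split=> // u Eu; have := Eu _ Ee0.
  case: u Eu => [[u|u]||] Eu.
  - by move=> _; rewrite lee_fin lez_nat m_min //; apply/asboolP.
  - by case: e0_nat => [->|[n ->]].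
  - by move=> _; exact: leey.
  - by case: e0_nat => [->|[n ->]].
move=> e0_nat; exists +oo%E; split=> [x _|u Eu]; first exact: leey.
case: u Eu => [u||] Eu; first last.
- by have := Eu _ Ee0; case: e0_nat => [->|[n ->]].
- exact: leey.
case: unb; exists `|u|%N; apply/asboolP => x /Eu /le_trans; apply.
by rewrite lee_fin lez_abs.
Qed.

Lemma number_of_ends_le1 (Gam : graph) :
  (number_of_ends Gam <= 1)%E <->
  forall K : set Gam, finite_set K ->
    is_subset1 (infinite_components (delete K)).
Proof.
rewrite /number_of_ends; set E := image _ _.
have sup_ex : supremums E !=set0.
  apply: supremums_nat => [|_ [K _ <-]]; last exact: ecard_nat.
  by exists (ecard (infinite_components (delete (set0 : set Gam)))), set0.
split=> [sup1 K finK|E1].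
  apply/ecard_le1; apply: le_trans sup1; apply: ge_supremum_Nmem => //.
  by exists K.
have Eu : ubound E 1%E by move=> _ [K finK <-]; apply/ecard_le1; exact: E1.
rewrite /supremum; case: eqP => // _; by case: (xgetPex 0%E sup_ex) => _; apply.
Qed.

Definition edge_boundary (Gam : graph) (A : set Gam) : set Gam :=
  [set x | exists y, adjacent x y /\ ~ (A x <-> A y)].

Definition locally_finite (Gam : graph) : Prop :=
  forall x : Gam, finite_set [set y | adjacent x y].

Definition connected_graph (Gam : graph) : Prop :=
  forall x y : Gam, connected_component x y.

Lemma connected_component_sym (Gam : graph) (x y : Gam) :
  connected_component x y -> connected_component y x.
Proof.
elim=> [{}x {}y xy|{}x|{}x {}y z _ yx _ zy]; last exact: rt_trans yx.
  by apply: rt_step; exact: adjacent_sym.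
exact: rt_refl.
Qed.

Lemma connected_component_eq (Gam : graph) (x y : Gam) :
  connected_component x y -> connected_component x = connected_component y.
Proof.
move=> xy; apply/seteqP; split=> z; last exact: rt_trans.
by apply: rt_trans; exact: connected_component_sym.
Qed.

Lemma connected_component_invariant (Gam : graph) (P : set Gam) :
  (forall x y, adjacent x y -> P x -> P y) ->
  forall x y, connected_component x y -> P x -> P y.
Proof.
by move=> adjP x y; elim=> {x y} [x y /adjP| |x y z _ xy _ yz /xy /yz].
Qed.

(** Follow a path of the whole graph from x until it first enters K: every
component of the complement of K contains a neighbour of K. For finite K in a
locally finite graph, this leaves only finitely many components. *)
Lemma reaches_deleted (Gam : graph) (K : set Gam) (k : Gam) :
  connected_graph Gam -> K k ->
  forall x : delete K, exists v : delete K,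
    (exists2 k', K k' & adjacent k' (val v)) /\ connected_component v x.
Proof.
move=> conn Kk x; move: {2}(val x) (erefl (val x)) => y xy.
have := conn y k => /(@clos_rt_rt1n _ _ _ _) yk.
elim: yk x xy Kk => {y k} [y|y z k yz _ IH] x xy Kk.
  by have := set_valP x; rewrite /= xy.
have [Kz|nKz] := pselect (K z).
  exists x; split; last exact: rt_refl.
  by exists z => //; rewrite xy; exact: adjacent_sym.
pose z' : delete K := exist _ z (mem_set (nKz : (~` K) z)).
have [v [Kv vz]] := IH z' erefl Kk; exists v; split=> //.
apply: rt_trans vz _; apply: rt_step; apply: adjacent_sym => /=.
by rewrite /delete_adjacent xy.
Qed.

Lemma finite_neighbours (Gam : graph) (K : set Gam) :
  locally_finite Gam -> finite_set K ->
  finite_set [set y | exists2 k, K k & adjacent k y].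
Proof.
move=> lf finK; have := bigcup_finite finK (fun k _ => lf k).
by apply: sub_finite_set => y [k Kk ky]; exists k.
Qed.

(** Delete the edge boundary K of A. The components of the rest lie in A or in
its complement and are finite in number, so if both A and its complement were
infinite then each would contain an infinite component. *)
Lemma finite_or_cofinite_of_ends (Gam : graph) (A : set Gam) :
  locally_finite Gam -> connected_graph Gam -> (number_of_ends Gam <= 1)%E ->
  finite_set (edge_boundary A) -> finite_set A \/ finite_set (~` A).
Proof.
move=> lf conn /number_of_ends_le1 ends1 finb.
have [?|infA] := pselect (finite_set A); first by left.
right; apply: contrapT => infcA.
(* The extra vertex x0 makes K nonempty even when A has empty boundary, so that
   there is always a deleted vertex to walk to. *)
have [x0 Ax0] := infinite_setN0 infA.
pose K := x0 |` edge_boundary A.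
have finK : finite_set K by rewrite finite_setU; split=> //; exact: finite_set1.
have finF : finite_set
    [set v : delete K | exists2 k, K k & adjacent k (val v)].
  apply: (finite_preimage (f := val) _ (finite_neighbours lf finK)).
  by move=> u v _ _; exact: val_inj.
have comp_stays (B : set Gam) : B = A \/ B = ~` A ->
    forall x y : delete K, connected_component x y -> B (val x) -> B (val y).
  move=> BA; apply: connected_component_invariant => x y xy Bx.
  have /not_orP[_ nbx] := set_valP x; apply: contrapT => nBy; apply: nbx.
  exists (val y); split=> // -[AB BA'].
  case: BA => BA; move: Bx nBy; rewrite BA.
    by move=> /AB.
  by move=> /= nA /contrapT /BA'.
have big_comp (B : set Gam) : B = A \/ B = ~` A -> infinite_set B ->
    exists v : delete K, B (val v) /\ infinite_set (connected_component v).
  move=> BA infB; apply: contrapT => /forallNP small; apply: infB.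
  have finC : finite_set (\bigcup_(v in [set v : delete K |
      (exists2 k, K k & adjacent k (val v)) /\ B (val v)])
      (val @` connected_component v)).
    apply: bigcup_finite => [|v [_ Bv]].
      by apply: sub_finite_set finF => v [].
    by apply: finite_image; apply: contrapT => inf; apply: (small v).
  apply: (sub_finite_set (B := K `|` _)); last first.
    by rewrite finite_setU; split; [exact: finK|exact: finC].
  move=> x Bx; have [Kx|nKx] := pselect (K x); [by left|right].
  pose x' : delete K := exist _ x (mem_set (nKx : (~` K) x)).
  have Kx0 : K x0 by left.
  have [v [Kv vx]] := reaches_deleted conn Kx0 x'.
  exists v; last by exists x'.
  split=> //; apply: (comp_stays _ BA x') => //.
  exact: connected_component_sym.
have [v [Av infv]] := big_comp A (or_introl erefl) infA.
have [w [Aw infw]] := big_comp _ (or_intror erefl) infcA.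
apply: Aw; apply: (comp_stays A (or_introl erefl) v) => //.
have -> : connected_component v = connected_component w.
  by apply: (ends1 K finK); split=> //; [exists v|exists w].
exact: rt_refl.
Qed.

(** A component of the complement of K has its edge boundary among K and the
neighbours of K, so two infinite components would give a forbidden cut. *)
Lemma ends_of_finite_or_cofinite (Gam : graph) :
  locally_finite Gam ->
  (forall A : set Gam, finite_set (edge_boundary A) ->
     finite_set A \/ finite_set (~` A)) ->
  (number_of_ends Gam <= 1)%E.
Proof.
move=> lf cuts; apply/number_of_ends_le1 => K finK _C _D.
move=> [[v ->] infv] [[w ->] infw]; apply: contrapT => vw.
have inf_val (C : set (delete K)) : infinite_set C -> infinite_set (val @` C).
  move=> infC fin_val; apply: infC.
  apply: (sub_finite_set (B := val @^-1` (val @` C))) => [x Cx|].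
    by exists x.
  by apply: finite_preimage fin_val => x y _ _; exact: val_inj.
have [||] := cuts (val @` connected_component v).
- apply: (sub_finite_set (B := K `|` [set y | exists2 k, K k & adjacent k y])).
    move=> x [y [xy nxy]]; have [Kx|nKx] := pselect (K x); [by left|right].
    have [Ky|nKy] := pselect (K y).
      by exists y => //; exact: adjacent_sym.
    pose x' : delete K := exist _ x (mem_set (nKx : (~` K) x)).
    pose y' : delete K := exist _ y (mem_set (nKy : (~` K) y)).
    case: nxy; split=> -[z vz zE].
      exists y' => //; apply: rt_trans vz _; apply: rt_step.
      by rewrite /= /delete_adjacent zE.
    exists x' => //; apply: rt_trans vz _; apply: rt_step.
    by rewrite /= /delete_adjacent zE; exact: adjacent_sym.
  by rewrite finite_setU; split=> //; exact: finite_neighbours.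
- exact: inf_val.
- apply: sub_infinite_set (inf_val _ infw) => _ [x wx <-] [y vy yx]; apply: vw.
  have /val_inj yx' := yx; subst y.
  by rewrite (connected_component_eq vy) -(connected_component_eq wx).
Qed.

(** * Commensurated and invariant sets *)

Definition almost_equal (T : Type) (A B : set T) : Prop :=
  finite_set [set x | ~ (A x <-> B x)].

Lemma almost_equal_refl (T : Type) (A : set T) : almost_equal A A.
Proof. by apply: (sub_finite_set (B := set0)) => // x /=; apply. Qed.

Lemma almost_equal_sym (T : Type) (A B : set T) :
  almost_equal A B -> almost_equal B A.
Proof. by apply: sub_finite_set => x /= nBA AB; apply: nBA; split=> /AB. Qed.

Lemma almost_equal_trans (T : Type) (B A C : set T) :
  almost_equal A B -> almost_equal B C -> almost_equal A C.
Proof.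
move=> AB BC; apply: (sub_finite_set (B := _ `|` _)); last first.
  by rewrite finite_setU; split; [exact: AB|exact: BC].
move=> x /= nAC; have [AxB|] := pselect (A x <-> B x); last by left.
by right=> BxC; apply: nAC; rewrite AxB.
Qed.

Lemma almost_equal_preimage (T U : Type) (f : T -> U) (A B : set U) :
  injective f -> almost_equal A B -> almost_equal (f @^-1` A) (f @^-1` B).
Proof. by move=> inj_f; apply: finite_preimage => x y _ _; exact: inj_f. Qed.

Definition commensurated (K : groupType) (Y : Type) (a : left_action K Y)
    (A : set Y) : Prop :=
  forall k, almost_equal (a k @^-1` A) A.

Definition invariant (K : groupType) (Y : Type) (a : left_action K Y)
    (A : set Y) : Prop :=
  forall k y, A y -> A (a k y).

Definition transfixes (K : groupType) : Prop :=
  forall (Y : Type) (a : left_action K Y) (A : set Y),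
    commensurated a A -> exists B, invariant a B /\ almost_equal A B.

Lemma actK (K : groupType) (Y : Type) (a : left_action K Y) (k : K) :
  cancel (a k) (a k^-1).
Proof. by move=> y; rewrite -actM mulVg act1. Qed.

Lemma actKV (K : groupType) (Y : Type) (a : left_action K Y) (k : K) :
  cancel (a k^-1) (a k).
Proof. by move=> y; rewrite -actM mulgV act1. Qed.

Lemma act_inj (K : groupType) (Y : Type) (a : left_action K Y) (k : K) :
  injective (a k).
Proof. exact: can_inj (actK a k). Qed.

Lemma invariantE (K : groupType) (Y : Type) (a : left_action K Y) (A : set Y) :
  invariant a A -> forall k y, A (a k y) <-> A y.
Proof.
by move=> invA k y; split; [move=> /(invA k^-1); rewrite actK|exact: invA].
Qed.

Lemma commensurated_almost_equal (K : groupType) (Y : Type)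
    (a : left_action K Y) (A B : set Y) :
  almost_equal A B -> commensurated a A -> commensurated a B.
Proof.
move=> AB commA k; apply: almost_equal_trans (AB).
apply: almost_equal_trans (commA k).
exact/almost_equal_preimage/almost_equal_sym/AB/act_inj.
Qed.

(** Bridges subgroups given by propositions and the bundled boolean predicates
in terms of which generation and left cosets are phrased. *)
Lemma subgroup_of_set (K : groupType) (P : set K) :
  P 1 -> (forall g h, P g -> P h -> P (g * h)) -> (forall g, P g -> P g^-1) ->
  exists L : groupClosed K, forall g, g \in L <-> P g.
Proof.
move=> P1 PM PV; pose L : {pred K} := fun g => `[< P g >].
have LP g : g \in L <-> P g by split=> [/asboolP|Pg] //; exact/asboolP.
have L1 : 1 \in L by exact/LP.
have LM : mulg_closed L by move=> g h /LP Pg /LP Ph; exact/LP/PM.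
have LV : invg_closed L by move=> g /LP Pg; exact/LP/PV.
pose mM := isMulClosed.Build K L LM.
pose m1 := isMul1Closed.Build K L L1.
pose mV := isInvClosed.Build K L LV.
by exists (HB.pack_for (groupClosed K) L mV m1 mM).
Qed.

Lemma generates_ind (K : groupType) (S : set K) (P : set K) :
  generates S -> P 1 -> (forall g h, P g -> P h -> P (g * h)) ->
  (forall g, P g -> P g^-1) -> (forall s, S s -> P s) -> forall g, P g.
Proof.
move=> genS P1 PM PV PS g; have [L LP] := subgroup_of_set P1 PM PV.
by apply/LP/genS => s /PS /LP.
Qed.

Lemma symmetric_generators (K : groupType) :
  finitely_generated K ->
  exists S : set K, [/\ finite_set S, symmetric_set S & generates S].
Proof.
move=> [S [finS genS]]; exists (S `|` [set s^-1 | s in S]); split.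
- by rewrite finite_setU; split=> //; exact: finite_image.
- move=> s; split=> -[Ss|[t St e]].
  + by right; exists s.
  + by left; rewrite -e invgK.
  + by right; exists s^-1; rewrite ?invgK.
  + by left; rewrite -(invgK s) -e invgK.
by move=> L LS; apply: genS => s Ss; apply: LS; left.
Qed.

(** * Schreier graphs as graphs of coset actions *)

Section Cosets.
Variables (K : groupType) (L : groupClosed K).

Lemma left_coset_eq (g h : K) :
  left_coset L g = left_coset L h <-> g^-1 * h \in L.
Proof.
split=> [e|ghL].
  have : left_coset L h h by exists 1; rewrite ?mulg1 //=; exact: gpred1.
  by rewrite -e => -[l Ll <-]; rewrite mulKg.
apply/seteqP; split=> _ [l Ll <-].
  exists ((g^-1 * h)^-1 * l); last by rewrite invgM invgK !mulgA mulgV mul1g.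
  by rewrite /= gpredMl // gpredV.
by exists (g^-1 * h * l); [rewrite /= gpredMl|rewrite -mulgA mulVKg].
Qed.

(** The action on cosets is defined through chosen representatives, which avoids
carrying proofs that a translated set is again a coset. *)
Definition coset_repr (v : left_cosets L) : K :=
  sval (cid2 (set_valP v)).

Lemma coset_reprE (v : left_cosets L) : left_coset L (coset_repr v) = \val v.
Proof. by rewrite /coset_repr; case: cid2. Qed.

Definition coset_of (g : K) : left_cosets L :=
  exist _ (left_coset L g) (mem_set (imageT (left_coset L) g)).

Lemma coset_ofP (g h : K) : coset_of g = coset_of h <-> g^-1 * h \in L.
Proof.
split=> [/(congr1 val)/left_coset_eq //|ghL].
exact/val_inj/left_coset_eq.
Qed.

Lemma coset_reprK : cancel coset_repr coset_of.
Proof. by move=> v; apply: val_inj => /=; exact: coset_reprE. Qed.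

Definition coset_act (k : K) (v : left_cosets L) : left_cosets L :=
  coset_of (k * coset_repr v).

Lemma coset_act_of (k g : K) : coset_act k (coset_of g) = coset_of (k * g).
Proof.
apply/coset_ofP; rewrite invgM -mulgA mulKg.
by apply/coset_ofP; exact: coset_reprK.
Qed.

Lemma coset_act1 v : coset_act 1 v = v.
Proof. by rewrite /coset_act mul1g coset_reprK. Qed.

Lemma coset_actM h k v : coset_act (h * k) v = coset_act h (coset_act k v).
Proof. by rewrite [X in coset_act h X]/coset_act coset_act_of mulgA. Qed.

Definition coset_action : left_action K (left_cosets L) :=
  LeftAction coset_act1 coset_actM.

Lemma coset_action_transitive (u v : left_cosets L) :
  exists k, coset_action k u = v.
Proof.
exists (coset_repr v * (coset_repr u)^-1).
by rewrite -(coset_reprK u) /= coset_act_of coset_reprK mulgVK coset_reprK.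
Qed.

Lemma schreier_adjacentE (S : set K) (u v : left_cosets L) :
  schreier_adjacent S u v <->
  exists2 s, S s & v = coset_action s u \/ u = coset_action s v.
Proof.
have step (s g : K) (x y : left_cosets L) :
    \val x = left_coset L g -> \val y = left_coset L (s * g) ->
    y = coset_action s x.
  move=> xE yE; have -> : x = coset_of g by exact: val_inj.
  by rewrite /= coset_act_of; exact: val_inj.
split=> [[s [g [Ss [[uE vE]|[vE uE]]]]]|[s Ss e]].
- by exists s => //; left; exact: step vE.
- by exists s => //; right; exact: step uE.
exists s; case: e => ->.
  exists (coset_repr u); split=> //; left.
  by rewrite coset_reprE.
by exists (coset_repr v); split=> //; right; rewrite coset_reprE.
Qed.

Lemma schreier_locally_finite (S : set K) :
  finite_set S -> locally_finite (schreier_graph L S).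
Proof.
move=> finS u; apply: (sub_finite_set (B :=
    [set coset_action s u | s in S] `|` [set coset_action s^-1 u | s in S])).
  move=> v /schreier_adjacentE[s Ss [->|->]]; first by left; exists s.
  by right; exists s; rewrite ?actK.
by rewrite finite_setU; split; exact: finite_image.
Qed.

Lemma schreier_connected (S : set K) :
  generates S -> connected_graph (schreier_graph L S).
Proof.
move=> genS u v; have [k <-] := coset_action_transitive u v.
have reach : forall k, forall w : schreier_graph L S,
    connected_component w (coset_action k w).
  apply: (generates_ind genS) => [w|g h gw hw w|g gw w|s Ss w].
  - by rewrite act1; exact: rt_refl.
  - by rewrite actM; exact: rt_trans (hw w) (gw _).
  - apply: connected_component_sym.
    by have := gw (coset_action g^-1 w); rewrite actKV.
  - by apply: rt_step; apply/schreier_adjacentE; exists s => //; left.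
exact: reach.
Qed.

Lemma edge_boundary_commensurated (S : set K) (A : set (left_cosets L)) :
  finite_set S -> commensurated coset_action A ->
  finite_set (edge_boundary (Gam := schreier_graph L S) A).
Proof.
move=> finS commA.
have fin (f : K -> K) : finite_set (\bigcup_(s in S)
    [set v | ~ (A (coset_action (f s) v) <-> A v)]).
  by apply: bigcup_finite => // s _; exact: commA.
apply: (sub_finite_set (B := _ `|` _)); last first.
  by rewrite finite_setU; split; [exact: (fin id)|exact: (fin (fun s => s^-1))].
move=> u [v [/schreier_adjacentE[s Ss vE] nuv]].
case: vE => vE; [left|right]; exists s => // uv; apply: nuv.
  by rewrite vE; exact: iff_sym.
have := actK coset_action s v; rewrite -vE => <-; exact: iff_sym.
Qed.

(** A finite edge boundary bounds the change of A under the generators only; the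
elements that almost preserve A form a subgroup. *)
Lemma commensurated_edge_boundary (S : set K) (A : set (left_cosets L)) :
  generates S -> finite_set (edge_boundary (Gam := schreier_graph L S) A) ->
  commensurated coset_action A.
Proof.
move=> genS finb; apply: (generates_ind genS).
- by apply: (sub_finite_set (B := set0)) => // u /=; rewrite coset_act1; apply.
- move=> g h commg commh; apply: almost_equal_trans commh.
  have -> : coset_action (g * h) @^-1` A =
      coset_action h @^-1` (coset_action g @^-1` A).
    by apply/seteqP; split=> u; rewrite /preimage /= coset_actM.
  exact/almost_equal_preimage/commg/act_inj.
- move=> g commg; apply: almost_equal_sym.
  have {1}-> : A = coset_action g^-1 @^-1` (coset_action g @^-1` A).
    apply/seteqP; split=> u; rewrite /preimage /= -coset_actM mulgV.
      by rewrite coset_act1.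
    by rewrite coset_act1.
  exact/almost_equal_preimage/commg/act_inj.
- move=> s Ss; apply: sub_finite_set finb => u /= nsu.
  exists (coset_action s u); split.
    by apply/schreier_adjacentE; exists s => //; left.
  by move=> us; apply: nsu; rewrite us.
Qed.

End Cosets.

(** * Property FW and transfixing groups *)

Section Orbits.
Variables (K : groupType) (Y : Type) (a : left_action K Y).

Lemma orbit_refl (y : Y) : act_orbit a y y.
Proof. by exists 1; rewrite ?act1. Qed.

Lemma act_orbitE (k : K) (y : Y) : act_orbit a (a k y) = act_orbit a y.
Proof.
apply/seteqP; split=> _ [h _ <-]; first by exists (h * k); rewrite ?actM.
by exists (h * k^-1); rewrite // -actM mulgVK.
Qed.

Lemma act_orbit_eq (y z : Y) : act_orbit a y z -> act_orbit a z = act_orbit a y.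
Proof. by move=> [k _ <-]; exact: act_orbitE. Qed.

Lemma orbit_stabilizer (y : Y) :
  exists (L : groupClosed K) (f : left_cosets L -> Y),
    [/\ injective f, forall k v, f (coset_action L k v) = a k (f v)
      & range f = act_orbit a y].
Proof.
have [] := @subgroup_of_set K [set k | a k y = y].
- exact: act1.
- by move=> g h /= gy hy; rewrite actM hy.
- by move=> g /= gy; rewrite -{1}gy actK.
move=> L LP; exists L, (fun v => a (coset_repr v) y).
have fof g : a (coset_repr (coset_of L g)) y = a g y.
  apply: (act_inj (a := a) (k := g^-1)); rewrite actK -actM; apply/LP.
  by apply/coset_ofP; rewrite coset_reprK.
split=> [u v uv|k v|].
- rewrite -(coset_reprK u) -(coset_reprK v); apply/coset_ofP/LP.
  by rewrite /= actM -uv actK.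
- by rewrite /= fof actM.
apply/seteqP; split=> [_ [v _ <-]|_ [k _ <-]]; first by exists (coset_repr v).
by exists (coset_of L k).
Qed.

End Orbits.

(** Transport A to the Schreier graph of the stabilizer of y. *)
Lemma orbit_finite_or_cofinite (K : groupType) (Y : Type) (a : left_action K Y)
    (A : set Y) :
  property_FW K -> commensurated a A ->
  forall y, finite_set (act_orbit a y `&` A) \/
            finite_set (act_orbit a y `\` A).
Proof.
move=> [/symmetric_generators[S [finS symS genS]] FW] commA y.
have [L [f [inj_f equi_f <-]]] := orbit_stabilizer a y.
have commfA : commensurated (coset_action L) (f @^-1` A).
  move=> k.
  have -> : coset_action L k @^-1` (f @^-1` A) = f @^-1` (a k @^-1` A).
    by apply/funext => v; rewrite /preimage /mkset equi_f.
  exact: almost_equal_preimage.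
have [finA|finA] := finite_or_cofinite_of_ends
  (schreier_locally_finite finS) (schreier_connected genS)
  (FW _ finS symS genS L)
  (edge_boundary_commensurated finS commfA).
- left; apply: sub_finite_set (finite_image f finA).
  by move=> _ [[v _ <-] Av]; exists v.
- right; apply: sub_finite_set (finite_image f finA).
  by move=> _ [[v _ <-] Av]; exists v.
Qed.

(** Let bd be the set of points at which some generator crosses between A and
its complement. An orbit that misses bd lies inside A or is disjoint from it;
each of the finitely many others meets A in a finite set or in the complement of
a finite set. Hence the orbits contained in A, together with those meeting A in
an infinite set, form an invariant set almost equal to A. *)
Lemma property_FW_transfixes (K : groupType) : property_FW K -> transfixes K.
Proof.
move=> FW Y a A commA; have dichotomy := orbit_finite_or_cofinite FW commA.
have [/symmetric_generators[S [finS _ genS]] _] := FW.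
pose bd := \bigcup_(s in S) [set z | ~ (A (a s z) <-> A z)].
have finbd : finite_set bd by apply: bigcup_finite => // s _; exact: commA.
have orbit_bd y z : ~ (act_orbit a y `&` bd !=set0) ->
    act_orbit a y z -> A z <-> A y.
  move=> nbd [k _ <-].
  have : forall k z, act_orbit a y z -> A (a k z) <-> A z.
    apply: (generates_ind genS) =>
      [{}z _|g h IHg IHh {}z yz|g IHg {}z yz|s Ss {}z yz].
    - by rewrite act1.
    - rewrite actM; apply: iff_trans (IHh _ yz); apply: IHg.
      by rewrite -(act_orbit_eq yz); exists h.
    - apply: iff_sym; rewrite -{1}(actKV a g z); apply: IHg.
      by rewrite -(act_orbit_eq yz); exists g^-1.
    - by apply: contrapT => nsz; apply: nbd; exists z; split=> //; exists s.
  by apply; exact: orbit_refl.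
pose C := [set y | act_orbit a y `<=` A \/ infinite_set (act_orbit a y `&` A)].
exists C; split=> [k y|]; first by rewrite /C /= act_orbitE.
(* The part of the orbit of y on which A and C differ, when that orbit
   meets bd. *)
pose small y := if pselect (finite_set (act_orbit a y `&` A))
  then act_orbit a y `&` A else act_orbit a y `\` A.
have fin_small y : finite_set (small y).
  by rewrite /small; case: pselect => // inf; case: (dichotomy y).
have := bigcup_finite finbd (fun y _ => fin_small y); apply: sub_finite_set.
move=> y /= nAC.
have [z [yz bdz]] : act_orbit a y `&` bd !=set0.
  apply: contrapT => nbd; apply: nAC; split=> [Ay|].
    by left=> z yz; apply/(orbit_bd y).
  case=> [sub|inf]; first exact/sub/orbit_refl.
  by have [z [yz Az]] := infinite_setN0 inf; apply/(orbit_bd y z).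
exists z => //; rewrite /small (act_orbit_eq yz).
case: pselect => [fin|inf]; split; try exact: orbit_refl.
  apply: contrapT => nAy; apply: nAC; split=> // -[sub|//].
  exact/sub/orbit_refl.
by move=> Ay; apply: nAC; split=> // _; right.
Qed.

(** The coset action is transitive, so an invariant set of cosets is empty or
full. *)
Lemma transfixes_property_FW (K : groupType) :
  finitely_generated K -> transfixes K -> property_FW K.
Proof.
move=> fgK tK; split=> // S finS symS genS L.
apply: ends_of_finite_or_cofinite; first exact: schreier_locally_finite.
move=> A /(commensurated_edge_boundary genS)/tK[B [invB AB]].
have [[u Bu]|B0] := pselect (B !=set0); [right|left].
  apply: sub_finite_set AB => v nAv AB; apply/nAv/AB.
  by have [k <-] := coset_action_transitive u v; exact: invB.
by apply: sub_finite_set AB => v Av AB; apply: B0; exists v; apply/AB.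
Qed.

(** * Extensions by transfixing groups *)

Section ImageAction.
Variables (K : groupType) (Y : Type) (a : left_action K Y).

Lemma image_act1 (O : set Y) : a 1 @` O = O.
Proof.
by rewrite (_ : act a 1 = id) ?image_id //; apply/funext => y; exact: act1.
Qed.

Lemma image_actM (h k : K) (O : set Y) : a (h * k) @` O = a h @` (a k @` O).
Proof.
by rewrite image_comp; apply: eq_imagel => y _; exact: actM.
Qed.

Definition image_action : left_action K (set Y) :=
  LeftAction (act := fun k O => a k @` O) image_act1 image_actM.

End ImageAction.

(** The twisting hypothesis says that the image of K in the permutations of Y
normalises the image of M; in particular K permutes the M-orbits, and B is a
union of such orbits. If an orbit is infinite, K cannot move it across the
border of B, because that would change B at infinitely many points. So on the
union of the infinite orbits B is already K-invariant. The finite M-orbits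
contained in B form a commensurated set A for the action of K on the subsets of
Y; replace A by an invariant set A', and take the union of the finite orbits
that belong to A'. This changes B at finitely many points, since only finitely
many orbits, all finite, are concerned. *)
Lemma transfixes_extension (M K : groupType) (Y : Type) (b : left_action M Y)
    (c : left_action K Y) (B : set Y) :
  transfixes K ->
  (forall k m, exists m', forall y, c k (b m y) = b m' (c k y)) ->
  invariant b B -> commensurated c B ->
  exists C, [/\ invariant b C, invariant c C & almost_equal B C].
Proof.
move=> tK twist invB commB.
have c_orbit k y : c k @` act_orbit b y = act_orbit b (c k y).
  apply/seteqP; split=> [_ [_ [m _ <-] <-]|_ [m _ <-]].
    by have [m' ->] := twist k m; exists m'.
  have [m' tw] := twist k^-1 m; exists (b m' y); first by exists m'.
  by apply: (act_inj (a := c) (k := k^-1)); rewrite actK tw actK.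
have B_orbit y z : act_orbit b y z -> B z <-> B y.
  by move=> [m _ <-]; exact: invariantE.
pose A := [set O | exists y, [/\ B y, O = act_orbit b y & finite_set O]].
have commA : commensurated (image_action c) A.
  move=> k; apply: sub_finite_set (finite_image (act_orbit b) (commB k)).
  move=> O /= nO; apply: contrapT => nbd; apply: nO; split.
    move=> [z [Bz zO finO]].
    have [y Oy yz] : (c k @` O) z by rewrite zO; exact: orbit_refl.
    have OE : O = act_orbit b y.
      rewrite -[LHS](actK (image_action c) k) /= zO c_orbit.
      by rewrite -yz actK.
    exists y; split=> //.
      apply: contrapT => nBy; apply: nbd; exists y => // By; apply: nBy.
      by apply/By; rewrite yz.
    rewrite -[O](actK (image_action c) k); exact: finite_image.
  move=> [y [By OE finO]]; exists (c k y); split; last exact: finite_image.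
    apply: contrapT => nBy; apply: nbd; exists y => // yB; apply: nBy.
    exact/yB.
  by rewrite OE c_orbit.
have [A' [invA' AA']] := tK _ _ _ commA.
(* A' may also contain sets that are not orbits; C never looks at them. *)
pose C := [set y | (infinite_set (act_orbit b y) /\ B y) \/
                   (finite_set (act_orbit b y) /\ A' (act_orbit b y))].
exists C; split.
- move=> m y; rewrite /C /= act_orbitE => -[[inf By]|]; last by right.
  by left; split=> //; exact: invB.
- move=> k y; rewrite /C /= -c_orbit => -[[inf By]|[fin A'y]]; [left|right].
    have infk : infinite_set (c k @` act_orbit b y).
      move=> fin; apply: inf; rewrite -[act_orbit b y](actK (image_action c) k).
      exact: finite_image.
    split=> //; apply: contrapT => nBy; apply: inf.
    apply: sub_finite_set (commB k) => z yz Bz; apply: nBy.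
    have : act_orbit b (c k y) (c k z) by rewrite -c_orbit; exists z.
    by move=> /B_orbit <-; apply/Bz/(B_orbit y).
  by split; [exact: finite_image|exact: invA'].
pose F (O : set Y) := [set y | O y /\ finite_set O].
have finF O : finite_set (F O).
  have [fin|inf] := pselect (finite_set O).
    by apply: sub_finite_set fin => y [].
  by apply: (sub_finite_set (B := set0)) => // y [_ /inf].
have := bigcup_finite AA' (fun O _ => finF O).
apply: sub_finite_set => y /= nBC.
have [fin|inf] := pselect (finite_set (act_orbit b y)); last first.
  case: nBC; split=> [By|]; first by left.
  by case=> -[].
exists (act_orbit b y); last by split=> //; exact: orbit_refl.
move=> /= iffO; apply: nBC; split=> [By|].
  by right; split=> //; apply/iffO; exists y.
case=> -[] // _ /iffO[z [Bz yz _]].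
by apply/(B_orbit z) => //; rewrite -yz; exact: orbit_refl.
Qed.

(** * Groups acting through a homomorphism *)

Section PullAction.
Variables (K W : groupType) (Y : Type) (f : K -> W).
Hypothesis fM : {morph f : k l / k * l}.
Variable a : left_action W Y.

Lemma pull_act1 y : a (f 1) y = y.
Proof.
have -> : f 1 = 1 by apply: (@mulgI _ (f 1)); rewrite -fM !mulg1.
exact: act1.
Qed.

Lemma pull_actM k l y : a (f (k * l)) y = a (f k) (a (f l) y).
Proof. by rewrite fM actM. Qed.

Definition pull_action : left_action K Y :=
  LeftAction (act := fun k => a (f k)) pull_act1 pull_actM.

Lemma commensurated_pull (A : set Y) :
  commensurated a A -> commensurated pull_action A.
Proof. by move=> commA k; exact: commA. Qed.

End PullAction.

Lemma transfixes_quotient (K W : groupType) (f : W -> K) :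
  {morph f : u v / u * v} -> (forall k, exists w, f w = k) ->
  transfixes W -> transfixes K.
Proof.
move=> fM surj tW Y c A commA.
have [B [invB AB]] := tW _ _ _ (commensurated_pull fM commA).
by exists B; split=> // k y; have [w <-] := surj k; exact: invB.
Qed.

(** * The wreath product *)

Lemma finite_set_ind (T : Type) (P : set T -> Prop) :
  P set0 -> (forall x A, P A -> P (x |` A)) -> forall A, finite_set A -> P A.
Proof.
elim/Pchoice: T => T in P *; move=> P0 PU A /finite_seqP[s ->].
elim: s => [|x s IH]; first by rewrite set_nil.
have -> : [set` x :: s] = x |` [set` s]; last exact: PU.
apply/seteqP; split=> y /=; rewrite in_cons.
  by case/orP => [/eqP|]; [left|right].
by case=> [->|->]; rewrite ?eqxx ?orbT.
Qed.

Section WreathElements.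
Variables (G H : groupType) (X : Type) (a : left_action H X).

Lemma single_finite (x : X) (g : G) :
  finite_set [set y | (if `[< y = x >] then g else 1) <> 1].
Proof.
by apply: sub_finite_set (finite_set1 x) => y /=; case: asboolP.
Qed.

Definition single (x : X) (g : G) : dirsum X G := DirSum (single_finite x g).

Lemma restrict_finite (D : set X) (phi : dirsum X G) :
  finite_set [set y | (if `[< D y >] then phi y else 1) <> 1].
Proof.
by apply: sub_finite_set (dirsum_finite phi) => y /=; case: asboolP.
Qed.

Definition restrict (D : set X) (phi : dirsum X G) : dirsum X G :=
  DirSum (restrict_finite D phi).

Definition base (phi : dirsum X G) : wreath G a := Wreath a phi 1.
Definition top (h : H) : wreath G a := Wreath a 1 h.

Lemma baseM : {morph base : phi psi / phi * psi}.
Proof.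
by move=> phi psi; apply: wreathP => [x|] /=; rewrite ?mulg1 // invg1 act1.
Qed.

Lemma topM : {morph top : h k / h * k}.
Proof. by move=> h k; apply: wreathP => [x|] //=; rewrite mulg1. Qed.

Lemma wreath_topM : {morph @wreath_top G H X a : u v / u * v}.
Proof. by []. Qed.

Lemma singleM (x : X) : {morph single x : g h / g * h}.
Proof.
by move=> g h; apply: dirsumP => y /=; case: asboolP; rewrite ?mulg1.
Qed.

Lemma restrictM (D : set X) : {morph restrict D : phi psi / phi * psi}.
Proof.
by move=> phi psi; apply: dirsumP => y /=; case: asboolP; rewrite ?mulg1.
Qed.

Lemma base_singleM (x : X) : {morph base \o single x : g h / g * h}.
Proof. by move=> g h; rewrite /= singleM baseM. Qed.

Lemma base_restrictM (D : set X) :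
  {morph base \o restrict D : phi psi / phi * psi}.
Proof. by move=> phi psi; rewrite /= restrictM baseM. Qed.

Lemma restrict0 (phi : dirsum X G) : restrict set0 phi = 1.
Proof. by apply: dirsumP => x /=; case: asboolP. Qed.

Lemma restrict_support (D : set X) (phi : dirsum X G) :
  [set x | phi x <> 1] `<=` D -> restrict D phi = phi.
Proof.
move=> phiD; apply: dirsumP => x /=; case: asboolP => // nDx.
by have [->|/phiD] := pselect (phi x = 1).
Qed.

Lemma restrictU1 (x : X) (D : set X) (phi : dirsum X G) :
  exists g, restrict (x |` D) phi = restrict D phi * single x g.
Proof.
exists (if `[< D x >] then 1 else phi x); apply: dirsumP => y /=.
have [->|yx] := asboolP (y = x).
  case: (asboolP ((x |` D) x)) => [_|[]]; last by left.
  by case: asboolP; rewrite ?mulg1 ?mul1g.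
rewrite mulg1; case: (asboolP (D y)) => Dy; case: asboolP => //.
  by case; right.
by case.
Qed.

Lemma single_restrict (x : X) (g : G) (D : set X) (phi : dirsum X G) :
  single x g * restrict D phi =
  restrict D (single x g * phi * (single x g)^-1) * single x g.
Proof.
apply: dirsumP => y /=; case: (asboolP (D y)) => Dy; first by rewrite mulgVK.
by rewrite mulg1 mul1g.
Qed.

Lemma top_base (h : H) (phi : dirsum X G) :
  top h * base phi = base (dirsum_act a h phi) * top h.
Proof.
by apply: wreathP => [x|] /=; rewrite !(mul1g, mulg1).
Qed.

Lemma wreathE (w : wreath G a) : w = base (wreath_base w) * top (wreath_top w).
Proof. by apply: wreathP => [x|] /=; rewrite ?mulg1 ?mul1g. Qed.

(** A base element is the product of its coordinates, multiplied in one at a time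
over its finite support. *)
Lemma wreath_ind (P : set (wreath G a)) :
  P 1 -> (forall u v, P u -> P v -> P (u * v)) ->
  (forall x g, P (base (single x g))) -> (forall h, P (top h)) ->
  forall w, P w.
Proof.
move=> P1 PM Psingle Ptop w; rewrite (wreathE w); apply: (PM) => //.
rewrite -(@restrict_support _ (wreath_base w) (@subset_refl _ _)).
elim/finite_set_ind: (dirsum_finite (wreath_base w)) => [|x D IH].
  by rewrite restrict0.
by have [g ->] := restrictU1 x D (wreath_base w); rewrite baseM; exact: PM.
Qed.

Lemma wreath_finitely_generated :
  finitely_generated G -> finitely_generated H -> finite_set [set: X] ->
  finitely_generated (wreath G a).
Proof.
move=> [SG [finSG genSG]] [SH [finSH genSH]] finX.
exists (\bigcup_(x in [set: X]) ((base \o single x) @` SG) `|` top @` SH).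
split.
  rewrite finite_setU; split; last exact: finite_image.
  by apply: bigcup_finite => // x _; exact: finite_image.
move=> L SL; have pull (K : groupType) (f : K -> wreath G a) (S : set K) :
    {morph f : k l / k * l} -> generates S -> (forall s, S s -> f s \in L) ->
    forall k, f k \in L.
  move=> fM genS Sf.
  have f1 : f 1 = 1 by apply: (@mulgI _ (f 1)); rewrite -fM !mulg1.
  apply: (generates_ind genS) => // [|k l|k fk]; first by rewrite f1 gpred1.
    by rewrite fM; exact: gpredM.
  by rewrite -(gpredMl _ fk) -fM mulgV f1 gpred1.
apply: wreath_ind => [|u v|x|]; [exact: gpred1|exact: gpredM| |].
- apply: (pull _ _ _ (base_singleM x) genSG) => s Ss.
  by apply: SL; left; exists x => //; exists s.
- by apply: (pull _ _ _ topM genSH) => s Ss; apply: SL; right; exists s.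
Qed.

(** The part of the base group treated so far, which consists of the elements
supported in D, enters through the endomorphism [restrict D] of the whole base
group: it has this subgroup as image, and no new group has to be built for each
D. *)
Lemma transfixes_wreath :
  transfixes G -> transfixes H -> finite_set [set: X] ->
  transfixes (wreath G a).
Proof.
move=> tG tH finX Y c A commA.
have [B [invB AB]] : exists B,
    invariant (pull_action (base_restrictM [set: X]) c) B /\ almost_equal A B.
  elim/finite_set_ind: finX => [|x D [B [invB AB]]].
    exists A; split; last exact: almost_equal_refl.
    by move=> phi y; rewrite /= restrict0 act1.
  have [||C [invC invxC BC]] := transfixes_extension
    (c := pull_action (base_singleM x) c) tG _ invB.
  - move=> g phi; exists (single x g * phi * (single x g)^-1) => y /=.
    by rewrite -!actM -!baseM single_restrict.
  - exact/commensurated_pull/commensurated_almost_equal/commA.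
  exists C; split; last exact: almost_equal_trans BC.
  move=> phi y Cy /=; have [g ->] := restrictU1 x D phi.
  by rewrite baseM actM; apply/(invC phi)/(invxC g).
have [||C [invC invHC BC]] := transfixes_extension
  (c := pull_action topM c) tH _ invB.
- move=> h phi; exists (dirsum_act a h phi) => y /=.
  by rewrite -!actM !restrict_support // top_base.
- exact/commensurated_pull/commensurated_almost_equal/commA.
exists C; split; last exact: almost_equal_trans BC.
apply: wreath_ind => [y|u v invu invv y Cy|x g y Cy|h y].
- by rewrite act1.
- by rewrite actM; exact/invu/invv.
- by have := invC (single x g) y Cy; rewrite /= restrict_support.
- exact: invHC.
Qed.

(** The imprimitive action: the wreath product permutes the fibres of the
projection to X, and moves points inside a fibre through the base coordinate of
the fibre in which they land. *)
Section FiberAction.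
Variables (Y : Type) (c : left_action G Y).

Definition fiber_act (w : wreath G a) (p : Y * X) : Y * X :=
  let x := a (wreath_top w) p.2 in (c (wreath_base w x) p.1, x).

Lemma fiber_act1 p : fiber_act 1 p = p.
Proof. by case: p => y x; rewrite /fiber_act /= !act1. Qed.

Lemma fiber_actM u v p : fiber_act (u * v) p = fiber_act u (fiber_act v p).
Proof. by rewrite /fiber_act /= [a (_ * _) _]actM actK actM. Qed.

Definition fiber_action : left_action (wreath G a) (Y * X) :=
  LeftAction fiber_act1 fiber_actM.

End FiberAction.

(** Finiteness of X is what makes A * X commensurated: an element of the wreath
product changes it by finitely many points in each of the fibres. *)
Lemma transfixes_wreath_base :
  finite_set [set: X] -> [set: X] !=set0 -> transfixes (wreath G a) ->
  transfixes G.
Proof.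
move=> finX [x0 _] tW Y c A commA.
have commAX : commensurated (fiber_action c) (A `*` [set: X]).
  move=> w.
  have : finite_set (\bigcup_(x in [set: X])
      [set (y, x) | y in
        [set y | ~ (A (c (wreath_base w (a (wreath_top w) x)) y) <-> A y)]]).
    by apply: bigcup_finite => // x _; apply: finite_image; exact: commA.
  apply: sub_finite_set => -[y x] /= nyx; exists x => //; exists y => //= iffy.
  by apply: nyx; split=> -[/iffy].
have [B [invB AB]] := tW _ _ _ commAX.
exists [set y | B (y, x0)]; split=> [g y By|].
  have := invB (base (single x0 g)) _ By.
  by rewrite /= /fiber_act /= act1; case: asboolP.
apply: sub_finite_set (finite_image fst AB) => y /= nAB.
exists (y, x0) => // -[AB1 BA1]; apply: nAB.
by split=> [Ay|/BA1[]//]; exact: AB1.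
Qed.

Definition left_translation (K : groupType) : left_action K K :=
  LeftAction (act := fun k l => k * l) (@mul1g K)
    (fun h k l => esym (mulgA h k l)).

(** If X were infinite, the fibre over some x would contain no point where A and
the invariant set B differ. There B would consist of the single point (1, x),
which an element g <> 1 in the coordinate x moves to (g, x). *)
Lemma transfixes_wreath_finite :
  (exists g : G, g <> 1) -> transfixes (wreath G a) -> finite_set [set: X].
Proof.
move=> [g g1] tW; pose A : set (G * X) := [set p | p.1 = 1].
have commA : commensurated (fiber_action (left_translation G)) A.
  move=> w; pose D := [set x | wreath_base w x <> 1].
  (* A point (k, x) can leave A only if k = 1, and enter A only if k is inverse
     to the coordinate of w that acts on it. *)
  have : finite_set
      ((fun x => (1, x)) @` (a (wreath_top w)^-1 @` D) `|`
       (fun x => ((wreath_base w x)^-1, a (wreath_top w)^-1 x)) @` D).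
    rewrite finite_setU.
    by split; do ?apply: finite_image; exact: dirsum_finite.
  apply: sub_finite_set => -[k x] /=.
  rewrite /A /preimage /= /fiber_act /= => nk.
  have Dx : D (a (wreath_top w) x).
    by move=> e; apply: nk; rewrite e mul1g.
  have [k1|k1] := pselect (k = 1).
    left; exists x; last by rewrite k1.
    by exists (a (wreath_top w) x) => //; rewrite actK.
  right; exists (a (wreath_top w) x) => //; rewrite actK; congr pair.
  by apply: contrapT => ke; apply: nk; split=> // /mulg1_eq.
have [B [invB AB]] := tW _ _ _ commA.
apply: sub_finite_set (finite_image snd AB).
move=> x _; apply: contrapT => nx.
have AxB k : A (k, x) <-> B (k, x).
  by apply: contrapT => nk; apply: nx; exists (k, x).
have B1 : B (1, x) by apply/AxB.
have := invB (base (single x g)) _ B1; rewrite /= /fiber_act /= act1.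
by case: asboolP => // _; rewrite mulg1 => /AxB.
Qed.

End WreathElements.

Theorem theorem1p2 (G H : groupType) (X : Type) (a : left_action H X)
    (fgG : finitely_generated G) (fgH : finitely_generated H)
    (G_nontrivial : exists g : G, g <> 1)
    (X_nonempty : [set: X] !=set0)
    (orbits_fin : finitely_many_orbits a) :
  property_FW (wreath G a) <->
  [/\ property_FW G, property_FW H & finite_set [set: X]].
Proof.
split=> [/property_FW_transfixes tW|[FWG FWH finX]].
  have finX := transfixes_wreath_finite G_nontrivial tW.
  split=> //; apply: transfixes_property_FW => //.
    exact: transfixes_wreath_base tW.
  apply: (transfixes_quotient (@wreath_topM G H X a)) tW => h.
  by exists (top G a h).
apply: transfixes_property_FW; first exact: wreath_finitely_generated.
by apply: transfixes_wreath => //; exact: property_FW_transfixes.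
Qed.
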